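(* Let $\Lambda_2,\Lambda_3,\Lambda_4\in\mathbb C$ with $\Lambda_4\ne0$, and let $\mathcal V^{[2]}$ be the Virasoro Whittaker module generated by $|J\rangle$ with $L_n|J\rangle=\Lambda_n|J\rangle$ ($n=2,3,4$), $L_n|J\rangle=0$ ($n>4$). There exists a unique formal series $|\Psi\rangle=\sum_{k\ge0}\Lambda_5^k|\Psi_k\rangle$, $|\Psi_0\rangle=|J\rangle$, $|\Psi_k\rangle\in\mathcal V^{[2]}$ independent of $\Lambda_5$, satisfying $L_n|\Psi\rangle=\Lambda_n|\Psi\rangle$ ($n=3,4,5$), $L_n|\Psi\rangle=0$ ($n>5$), and the orthogonal gauge $\xi(|\Psi_k\rangle)=\delta_{k,0}$. For every $k\in\mathbb N$ its component $|\Psi_k\rangle$ belongs to $V_k^{(1)}$. If in addition $\Lambda_3=0$, then $|\Psi_k\rangle\in V_k^{(2)}\subset V_k^{(1)}$.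
   Context: Basis $v_\lambda=\mathbf L_{-\lambda}|J\rangle$, $\mathbf L_{-\lambda}=L_{-\lambda_1+2}\cdots L_{-\lambda_\ell+2}$ for partitions $\lambda=(\lambda_1\ge\dots\ge\lambda_\ell\ge1)$, $v_\emptyset=|J\rangle$; $\xi$ is the linear functional giving the coefficient of $|J\rangle$ in this basis. $|\lambda|=\sum\lambda_i$, $U_m=\operatorname{span}\{v_\lambda:|\lambda|\le m\}$. For $\delta\in\{1,2\}$ and $\lambda=(\cdots3^{n_3}2^{n_2}1^{n_1})$, $\deg_\delta v_\lambda=n_1+\delta n_2+\sum_{k>2}n_k(k-2)$ (i.e. $\deg_\delta L_{-k}=k$ for $k>0$, $\deg_\delta L_0=\delta$, $\deg_\delta L_1=1$). $V_k^{(\delta)}=\operatorname{span}\{v_\lambda\in U_{3k}:\deg_\delta v_\lambda\le k\}$. The relations on $|\Psi\rangle$ hold order by order in $\Lambda_5$. *)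

(* Defs.v *)
From HB Require Import structures.
From mathcomp Require Import all_boot all_order all_algebra.
Set Implicit Arguments. Unset Strict Implicit. Unset Printing Implicit Defensive.
Import Order.TTheory GRing.Theory Num.Theory.
Local Open Scope ring_scope.

Definition is_part (s : seq nat) : bool :=
  sorted geq s && all (fun i => 0 < i)%N s.

Definition psize (s : seq nat) : nat := sumn s.

Definition pdeg (delta : nat) (s : seq nat) : nat :=
  sumn (map (fun i => if i == 1%N then 1%N else if i == 2%N then delta else (i - 2)%N) s).

Section Vir.
Variables (K : fieldType) (V : lmodType K).

Definition vbasis (L : int -> V -> V) (J : V) (s : seq nat) : V :=
  foldr (fun i : nat => fun v : V => L (2 - Posz i) v) J s.

Definition in_span (L : int -> V -> V) (J : V) (P : pred (seq nat)) (v : V) : Prop :=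
  exists s : seq (K * seq nat),
    all (fun p => is_part p.2 && P p.2) s /\
    v = \sum_(p <- s) p.1 *: vbasis L J p.2.

Definition is_PBW_basis (L : int -> V -> V) (J : V) : Prop :=
  (forall v, in_span L J predT v) /\
  (forall s : seq (K * seq nat),
      uniq (map snd s) -> all is_part (map snd s) ->
      \sum_(p <- s) p.1 *: vbasis L J p.2 = 0 ->
      all (fun p => p.1 == 0) s).

(* xi(v) = a : the coefficient of v_emptyset = |J> of v in the basis is a,
   i.e. v - a|J> lies in the span of the v_lambda with lambda nonempty. *)
Definition xi_is (L : int -> V -> V) (J : V) (v : V) (a : K) : Prop :=
  in_span L J (fun s => s != [::]) (v - a *: J).

Definition Vk (L : int -> V -> V) (J : V) (delta k : nat) (v : V) : Prop :=
  in_span L J (fun s => (psize s <= 3 * k)%N && (pdeg delta s <= k)%N) v.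

Definition virasoro_rep (c : K) (L : int -> V -> V) : Prop :=
  forall (m n : int) (v : V),
    L m (L n v) - L n (L m v) =
      (m - n)%:~R *: L (m + n) v
      + (if m + n == 0 then c / 12%:R * (m ^+ 3 - m)%:~R else 0) *: v.
End Vir.

(* Main.v *)
(** Put [X_k = L_(2-k)] for [k >= 1], [D_j = L_(2+j) - La_j] for [j >= 0], and
    filter the module by giving [X_k] weight [k].  Then [D_j] lowers the weight
    by [j] and, up to lower order, is [2 j La4] times the derivation dual to
    [X_j]; hence the Euler operator [sum_j X_j D_j] is [2 La4 w] on the graded
    piece of weight [w].  This gives both halves of the theorem: a vector killed
    by all [D_j], [j >= 1], is a multiple of [J], and the system [D_j v = y_j]
    with [D_i y_j - D_j y_i = (i - j) y_(i+j+2)] has the approximate solution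
    [(2 La4 w)^-1 sum_j X_j y_j], whose error has lower weight, so that it is
    solved by iteration (a Poincare lemma).  [Psi_(k+1)] is the solution for
    [y_3 = Psi_k] and [y_j = 0] otherwise.  The degree bounds hold because
    [deg_delta] defines another filtration that the same operators respect; the
    gauge condition is automatic since reordering a nonempty word in the [X_k]
    never produces the empty one. *)
Require Import Defs.
From HB Require Import structures.
From Stdlib Require Import FunctionalExtensionality.
From mathcomp Require Import all_boot all_order all_algebra.
From mathcomp Require Import zify ring.
Import Order.TTheory GRing.Theory Num.Theory.
Local Open Scope ring_scope.

Set Implicit Arguments. Unset Strict Implicit. Unset Printing Implicit Defensive.

(** * Spans of families indexed by words, and their intersections under linear independence *)

Section Span.
Variables (K : fieldType) (V : lmodType K) (f : seq nat -> V).

Definition wspan (P : pred (seq nat)) (v : V) : Prop :=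
  exists s : seq (K * seq nat),
    all (fun p => P p.2) s /\ v = \sum_(p <- s) p.1 *: f p.2.

Lemma wspan_ind (P : pred (seq nat)) (Q : V -> Prop) :
  Q 0 -> (forall a s v, P s -> Q v -> Q (a *: f s + v)) ->
  forall v, wspan P v -> Q v.
Proof.
move=> Q0 QS v [s [Ps ->]]; elim: s Ps => [|p s IH] /=; first by rewrite big_nil.
by case/andP=> Pp /IH Qs; rewrite big_cons; apply: QS.
Qed.

Lemma wspan0 (P : pred (seq nat)) : wspan P 0.
Proof. by exists [::]; rewrite big_nil. Qed.

Lemma wspanD (P : pred (seq nat)) u v : wspan P u -> wspan P v -> wspan P (u + v).
Proof.
move=> [s [Ps ->]] [t [Pt ->]]; exists (s ++ t).
by rewrite all_cat Ps Pt big_cat.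
Qed.

Lemma wspanZ (P : pred (seq nat)) a v : wspan P v -> wspan P (a *: v).
Proof.
move=> [s [Ps ->]]; exists [seq (a * p.1, p.2) | p <- s].
rewrite all_map big_map scaler_sumr; split; first exact: Ps.
by apply: eq_bigr => p _; rewrite scalerA.
Qed.

Lemma wspanB (P : pred (seq nat)) u v : wspan P u -> wspan P v -> wspan P (u - v).
Proof. by move=> Pu Pv; apply: wspanD => //; rewrite -scaleN1r; apply: wspanZ. Qed.

Lemma wspan_mem (P : pred (seq nat)) s : P s -> wspan P (f s).
Proof.
move=> Ps; exists [:: (1, s)] => /=; rewrite Ps big_cons big_nil.
by rewrite scale1r addr0.
Qed.

Lemma wspan_sum_nat (P : pred (seq nat)) m n (F : nat -> V) :
  (forall j, (m <= j < n)%N -> wspan P (F j)) -> wspan P (\sum_(m <= j < n) F j).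
Proof.
move=> PF; rewrite big_nat.
by apply: (big_ind (wspan P)); [exact: wspan0 | exact: wspanD |].
Qed.

Lemma wspan_linear (h : V -> V) (P Q : pred (seq nat)) :
  linear h -> (forall s, P s -> wspan Q (h (f s))) ->
  forall v, wspan P v -> wspan Q (h v).
Proof.
move=> lh PQ; apply: (@wspan_ind P (fun v => wspan Q (h v))) => [|a s u Ps Qu].
  have := lh (-1) 0 0; rewrite scaler0 addr0 scaleN1r addNr => ->; exact: wspan0.
by rewrite lh; apply: wspanD => //; apply: wspanZ; apply: PQ.
Qed.

Lemma wspan_trans (P Q : pred (seq nat)) v :
  (forall s, P s -> wspan Q (f s)) -> wspan P v -> wspan Q v.
Proof. by move=> PQ; apply: (@wspan_linear id). Qed.

Lemma wspanW (P Q : pred (seq nat)) v :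
  (forall s, P s -> Q s) -> wspan P v -> wspan Q v.
Proof. by move=> PQ; apply: wspan_trans => s /PQ; apply: wspan_mem. Qed.

Lemma wspan_pred0 (P : pred (seq nat)) v :
  (forall s, ~~ P s) -> wspan P v -> v = 0.
Proof.
move=> nP; move: v; apply: (@wspan_ind P (fun v => v = 0)) => // a s u Ps.
by case/negP: (nP s).
Qed.

Definition wcoef (s : seq (K * seq nat)) (x : seq nat) : K :=
  \sum_(p <- s | p.2 == x) p.1.

Lemma wcoef_expand (s : seq (K * seq nat)) (r : seq (seq nat)) :
  uniq r -> {subset map snd s <= r} ->
  \sum_(p <- s) p.1 *: f p.2 = \sum_(x <- r) wcoef s x *: f x.
Proof.
move=> Ur; elim: s => [|p s IH] sub.
  by rewrite big_nil big1 // => x _; rewrite /wcoef big_nil scale0r.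
rewrite big_cons IH; last by move=> x xs; apply: sub; rewrite inE xs orbT.
have pr : p.2 \in r by apply: sub; rewrite inE eqxx.
have ->: p.1 *: f p.2 = \sum_(x <- r) (if p.2 == x then p.1 else 0) *: f x.
  rewrite (bigD1_seq p.2) //= eqxx big1 ?addr0 // => x.
  by rewrite eq_sym => /negPf ->; rewrite scale0r.
rewrite -big_split /=; apply: eq_bigr => x _; rewrite -scalerDl /wcoef big_cons.
by case: (p.2 == x); rewrite ?add0r.
Qed.

Lemma wcoef_notin s x : x \notin map snd s -> wcoef s x = 0.
Proof.
move=> xs; rewrite /wcoef big_seq_cond big1 // => p /andP[ps /eqP px].
by case/negP: xs; rewrite -px; apply: map_f.
Qed.

(** Independence forces the two expansions to have equal coefficients, so a word with nonzero
    coefficient occurs in both. This later merges the size and degree bounds, and makes a vector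
    vanish when [P] and [Q] are incompatible. *)
Lemma wspanI (B P Q : pred (seq nat)) v :
  (forall s : seq (K * seq nat), uniq (map snd s) -> all B (map snd s) ->
      \sum_(p <- s) p.1 *: f p.2 = 0 -> all (fun p => p.1 == 0) s) ->
  wspan (predI B P) v -> wspan (predI B Q) v -> wspan (predI B (predI P Q)) v.
Proof.
move=> free [s [Ps Es]] [t [Pt Et]].
pose r := undup (map snd s ++ map snd t).
have Ur : uniq r by apply: undup_uniq.
have ss : {subset map snd s <= r}.
  by move=> x xs; rewrite mem_undup mem_cat xs.
have st : {subset map snd t <= r}.
  by move=> x xs; rewrite mem_undup mem_cat xs orbT.
have mB (u : seq (K * seq nat)) (P' : pred (seq nat)) x : all (fun p => predI B P' p.2) u ->
    x \in map snd u -> predI B P' x.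
  by move=> /allP au /mapP[p pu ->]; apply: au.
have eq_coef x : x \in r -> wcoef s x = wcoef t x.
  move=> xr.
  suff /allP/(_ (wcoef s x - wcoef t x, x)) : all (fun p : K * seq nat => p.1 == 0)
      [seq (wcoef s y - wcoef t y, y) | y <- r].
    by rewrite /= subr_eq0 => H; apply/eqP/H/mapP; exists x.
  apply: free.
  - by rewrite -map_comp map_id.
  - rewrite -map_comp map_id; apply/allP=> y; rewrite mem_undup mem_cat.
    by case/orP=> [/(mB _ _ _ Ps)|/(mB _ _ _ Pt)] /andP[].
  - rewrite big_map /=.
    under eq_bigr do rewrite scalerBl.
    by rewrite sumrB -!wcoef_expand // -Es -Et subrr.
exists [seq (wcoef s y, y) | y <- r & wcoef s y != 0]; split; last first.
  rewrite Es (wcoef_expand Ur ss) big_map big_filter [RHS]big_mkcond /=.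
  apply: eq_bigr => x _; case: eqP => [->|//]; by rewrite scale0r.
rewrite all_map; apply/allP => x; rewrite mem_filter => /andP[c0 xr] /=.
have /(mB _ _ _ Ps)/andP[-> ->] : x \in map snd s.
  by apply: contraNT c0 => /wcoef_notin ->.
have /(mB _ _ _ Pt)/andP[_ ->] : x \in map snd t.
  by apply: contraNT c0 => /wcoef_notin; rewrite eq_coef // => ->.
by [].
Qed.

End Span.

(** * The shifted operators [D j] and their commutation relations *)

Section Whittaker.
Variables (K : numFieldType) (V : lmodType K) (c : K).
Variables (L : int -> {linear V -> V}) (J : V) (La2 La3 La4 : K).
Hypothesis virL : virasoro_rep c (fun n => L n).
Hypothesis LJ2 : L 2%:Z J = La2 *: J.
Hypothesis LJ3 : L 3%:Z J = La3 *: J.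
Hypothesis LJ4 : L 4%:Z J = La4 *: J.
Hypothesis LJ_gt4 : forall n : int, 4%:Z < n -> L n J = 0.

Local Notation X k := (L (2 - Posz k)).
Local Notation vb := (Defs.vbasis (fun n => L n) J).

Definition La (j : nat) : K := nth 0 [:: La2; La3; La4] j.

Lemma La_gt2 j : (2 < j)%N -> La j = 0.
Proof. by move=> j2; rewrite /La nth_default. Qed.

Definition D (j : nat) (v : V) : V := L (2 + Posz j) v - La j *: v.

Lemma D_linear j : linear (D j).
Proof.
move=> a u v; rewrite /D linearP scalerDr scalerBr !scalerA [La j * a]mulrC.
by rewrite opprD addrACA.
Qed.

HB.instance Definition _ j :=
  GRing.isLinear.Build K V V _ (D j) (D_linear j).

Lemma D_J j : D j J = 0.
Proof.
rewrite /D /La; case: j => [|[|[|j]]] /=.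
- by rewrite addr0 LJ2 subrr.
- by rewrite -[2 + 1]/(3%:Z) LJ3 subrr.
- by rewrite -[2 + 2%:Z]/(4%:Z) LJ4 subrr.
- by rewrite LJ_gt4 ?nth_nil ?scale0r ?subr0 //; lia.
Qed.

(* [L_(4 + j - k)], the operator in the commutator of [L_(2 + j)] and [L_(2 - k)]. *)
Definition T (j k : nat) (v : V) : V :=
  if (k <= j.+2)%N then D (j.+2 - k) v + La (j.+2 - k) *: v else X (k - j.+2) v.

Lemma TE j k v : T j k v = L (4 + Posz j - Posz k) v.
Proof.
rewrite /T /D; case: leqP => jk; last by congr (L _ v); lia.
by rewrite subrK; congr (L _ v); lia.
Qed.

(** The test [k == j.+4] says that the modes [2 + j] and [2 - k] add up to zero. *)
Definition central (j k : nat) : K :=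
  if k == j.+4 then c / 12%:R * (((2 + Posz j) ^+ 3 - (2 + Posz j))%:~R) else 0.

Lemma DX j k v :
  D j (X k v) = X k (D j v) + ((j + k)%:R *: T j k v + central j k *: v).
Proof.
rewrite /D [X k (_ - _)]linearB [X k (_ *: _)]linearZ /= [RHS]addrAC; congr (_ - _).
have /eqP := virL (2 + Posz j) (2 - Posz k) v.
rewrite subr_eq [eqbRHS]addrC => /eqP ->; congr (_ + (_ *: _ + _ *: _)).
- have -> : 2 + Posz j - (2 - Posz k) = Posz (j + k) by lia.
  by [].
- by rewrite TE; congr (L _ v); lia.
- rewrite /central; case: eqP => [e|e]; case: eqP => // e'; lia.
Qed.

Lemma DD i j v :
  D i (D j v) - D j (D i v) = (Posz i - Posz j)%:~R *: D (i + j).+2 v.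
Proof.
have comm : D i (D j v) - D j (D i v) =
    L (2 + Posz i) (L (2 + Posz j) v) - L (2 + Posz j) (L (2 + Posz i) v).
  have DDE m n : D m (D n v) = L (2 + Posz m) (L (2 + Posz n) v) -
      (La n *: L (2 + Posz m) v + La m *: L (2 + Posz n) v - (La m * La n) *: v).
    rewrite /D [L (2 + Posz m) (_ - _)]linearB [L _ (_ *: _)]linearZ /=.
    by rewrite scalerBr scalerA -addrA -opprD addrA.
  rewrite !DDE [La j * La i]mulrC [La j *: _ + _]addrC.
  by set S := (_ + _ - _ *: v); rewrite [- (_ - S)]opprB subrKA.
rewrite comm virL.
have -> : (2 + Posz i + (2 + Posz j) == 0) = false by apply/eqP; lia.
rewrite scale0r addr0.
have -> : 2 + Posz i - (2 + Posz j) = Posz i - Posz j by lia.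
have -> : 2 + Posz i + (2 + Posz j) = 2 + Posz (i + j).+2 by lia.
(* The subtracted constant has index [i + j + 2], so it vanishes if [i + j > 0]; for [i = j = 0] it
   is [La4], but then its coefficient [i - j] is zero. *)
rewrite /D; case: (posnP (i + j)) => [ij|ij]; last first.
  by rewrite [La _]La_gt2 ?scale0r ?subr0 //; lia.
have -> : Posz i - Posz j = 0 by lia.
by rewrite !scale0r.
Qed.

(* The central term never occurs: [a + b = 4] with [a, b > 0] means
   [2 - a] is in [{-1, 0, 1}], where [m ^ 3 - m] vanishes. *)
Lemma XX a b v : (0 < a)%N -> (0 < b)%N ->
  X a (X b v) = X b (X a v) + (Posz b - Posz a)%:~R *: X (a + b - 2) v.
Proof.
move=> a0 b0; have /eqP := virL (2 - Posz a) (2 - Posz b) v.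
rewrite subr_eq [eqbRHS]addrC => /eqP ->; congr (_ + _).
have -> : 2 - Posz a - (2 - Posz b) = Posz b - Posz a by lia.
have -> : 2 - Posz a + (2 - Posz b) = 2 - Posz (a + b - 2) by lia.
set z := (if _ then _ else _); suff -> : z = 0 by rewrite scale0r addr0.
rewrite /z; case: eqP => // e.
have -> : (2 - Posz a) ^+ 3 - (2 - Posz a) = 0; last by rewrite mulr0.
have : (a <= 3)%N by lia.
by move: a0 {e z}; case: a => [|[|[|[|a]]]].
Qed.

(** * Filtrations defined by a weight [g] on letters *)

Section Filtration.
Variable g : nat -> nat.

Definition gsum (s : seq nat) : nat := sumn (map g s).

(* Level [d - a] of the filtration, which is [0] when [d < a]. *)
Definition Fil (a d : nat) : V -> Prop :=
  wspan vb (fun s => all (leq 1) s && (gsum s + a <= d)%N).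

Lemma FilW a d a' d' v :
  (a' + d <= a + d')%N -> Fil a d v -> Fil a' d' v.
Proof.
by move=> le; apply: wspanW => s /andP[-> gs] /=; lia.
Qed.

(** The words in [Fil] need not be sorted, so [X k] merely prepends a letter; [word_straighten]
    restores the order at the end. *)
Lemma X_Fil k a d v : (0 < k)%N -> Fil a d v -> Fil a (d + g k) (X k v).
Proof.
move=> k0; apply: wspan_linear => [|s /andP[ps gs]]; first exact: linearP.
apply: (@wspan_mem _ _ _ _ (k :: s)) => /=.
by rewrite k0 ps /gsum /=; move: gs; rewrite /gsum; lia.
Qed.

(** In the commutator of [D j] with [X k], the first condition controls [X (k - j.+2)], the [La2]
    term and the central term; the second controls [D (j.+2 - k)], and later the letters merged by
    reordering; the third controls the [La3] term, which occurs for [k = j.+1]. *)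
Definition filt_weight : Prop :=
  [/\ forall a b, (g a + g b <= g (a + b).+2)%N,
      forall a b, (2 <= a + b)%N -> (g (a + b - 2) <= g a + g b)%N
    & La3 = 0 \/ forall j, (g j <= g j.+1)%N].

Hypothesis g_ok : filt_weight.

Lemma T_Fil (v : V) j k a d :
  (0 < k)%N -> Fil a d v -> (forall i, Fil (a + g i) d (D i v)) ->
  Fil (a + g j) (d + g k) (T j k v).
Proof.
have [g_super g_sub g_mono] := g_ok; move=> k0 Fv FD; rewrite /T; case: leqP => jk.
  apply: wspanD.
    apply: FilW (FD _).
    by have := @g_sub k (j.+2 - k)%N; have -> : (k + (j.+2 - k) - 2 = j)%N; lia.
  have [m2|m2] := ltnP 2 (j.+2 - k)%N.
    by rewrite La_gt2 // scale0r; apply: wspan0.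
  have [m1|m1] := eqVneq (j.+2 - k)%N 1%N.
    case: g_mono => [La30|gm]; first by rewrite m1 /La /= La30 scale0r; apply: wspan0.
    apply: wspanZ; apply: FilW Fv; have := gm j.
    have -> : j.+1 = k by lia.
    lia.
  apply: wspanZ; apply: FilW Fv.
  have : (k = j \/ k = j.+2)%N by lia.
  case=> ->; first by lia.
  by have := g_super j 0; rewrite addn0; lia.
have k0' : (0 < k - j.+2)%N by lia.
apply: FilW (X_Fil k0' Fv).
have := g_super (k - j.+2)%N j.
have -> : (k - j.+2 + j).+2 = k by lia.
lia.
Qed.

Lemma D_Fil j a d v : Fil a d v -> Fil (a + g j) d (D j v).
Proof.
apply: wspan_linear => [|s /andP[ps gs]]; first exact: linearP.
(* The induction keeps [j] general, since moving [D j] past a letter brings other [D i] to act on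
   the tail. *)
have : Fil (g j) (gsum s) (D j (vb s)).
  elim: s ps j {gs} => [|k s IH] /=; first by move=> _ j; rewrite D_J; apply: wspan0.
  move=> /andP[k0 ps] j; rewrite DX.
  have Fs : Fil 0 (gsum s) (vb s) by apply: wspan_mem; rewrite ps addn0 /=.
  have gk : gsum (k :: s) = (gsum s + g k)%N by rewrite /gsum /= addnC.
  rewrite gk; apply: wspanD; first by apply: X_Fil => //; apply: IH.
  apply: wspanD.
    apply: wspanZ; rewrite -[g j]add0n; apply: T_Fil => // i; exact: IH.
  rewrite /central; case: eqP => [->|_]; last by rewrite scale0r; apply: wspan0.
  apply: wspanZ; apply: FilW Fs.
  by have [/(_ j 2)] := g_ok; rewrite addn2; lia.
by apply: FilW; lia.
Qed.

End Filtration.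

(** * Leading terms for the weight filtration, and the Euler operator *)

Local Notation U := (Fil id).

Lemma gsum_id s : gsum id s = sumn s.
Proof. by rewrite /gsum map_id. Qed.

Lemma D_U j a d v : U a d v -> U (a + j) d (D j v).
Proof. by apply: D_Fil; split=> [*|*|] /=; [lia | lia | right; lia]. Qed.

Lemma X_U k a d v : (0 < k)%N -> U a d v -> U a (d + k) (X k v).
Proof. exact: X_Fil. Qed.

Lemma U_eq0 a d v : (d < a)%N -> U a d v -> v = 0.
Proof. by move=> lt_da; apply: wspan_pred0 => s; rewrite negb_and; lia. Qed.

(** Only [La4], met for [k = j], has full weight. The terms with [La3] ([k = j.+1]) and [La2]
    ([k = j.+2]) fall short by 1 and 2, and the operator terms [D] and [X] by 2. *)
Lemma T_lead j k a d v : (0 < k)%N -> U a d v ->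
  U (a + j).+1 (d + k) (T j k v - ((j == k)%:R * La4) *: v).
Proof.
move=> k0 Uv; rewrite /T; case: leqP => jk; last first.
  have k0' : (0 < k - j.+2)%N by lia.
  have -> : (j == k) = false by lia.
  rewrite mul0r scale0r subr0; apply: FilW (X_U k0' Uv); lia.
rewrite -addrA; apply: wspanD; first by apply: FilW (D_U _ Uv); lia.
rewrite -scalerBl; have [->|njk] := eqVneq j k.
  have -> : (k.+2 - k = 2)%N by lia.
  by rewrite mul1r subrr scale0r; apply: wspan0.
rewrite mul0r subr0; have [m2|m2] := ltnP 2 (j.+2 - k)%N.
  by rewrite La_gt2 // scale0r; apply: wspan0.
by apply: wspanZ; apply: FilW Uv; lia.
Qed.

(* Up to lower order, [D j] is [2 * j * La4] times the derivation dual to [X j]. *)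
Lemma DX_lead j k a d v : (0 < k)%N -> U a d v ->
  U (a + j).+1 (d + k)
    (D j (X k v) - (X k (D j v) + ((j == k)%:R * (2 * k%:R * La4)) *: v)).
Proof.
move=> k0 Uv; rewrite DX opprD addrACA subrr add0r addrAC.
apply: wspanD; last first.
  rewrite /central; case: eqP => [->|_]; last by rewrite scale0r; apply: wspan0.
  by apply: wspanZ; apply: FilW Uv; lia.
have -> : ((j == k)%:R * (2 * k%:R * La4)) *: v =
    (j + k)%:R *: (((j == k)%:R * La4) *: v).
  rewrite scalerA; congr (_ *: _); case: eqP => [->|_]; last by rewrite !mul0r mulr0.
  by rewrite natrD; ring.
by rewrite -scalerBr; apply: wspanZ; apply: T_lead.
Qed.

(** The truncation loses nothing on weight at most [N], where [D j] vanishes for [j > N]. *)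
Definition Euler (N : nat) (v : V) : V := \sum_(1 <= j < N.+1) X j (D j v).

Lemma Euler_linear N : linear (Euler N).
Proof.
move=> a u v; rewrite /Euler scaler_sumr -big_split /=; apply: eq_bigr => j _.
by rewrite !linearP.
Qed.

HB.instance Definition _ N :=
  GRing.isLinear.Build K V V _ (Euler N) (Euler_linear N).

Lemma sum_delta k N (x : K) (F : nat -> V) : (0 < k <= N)%N ->
  \sum_(1 <= j < N.+1) ((j == k)%:R * x) *: F j = x *: F k.
Proof.
move=> kN; rewrite (bigD1_seq k) ?iota_uniq ?mem_index_iota //= ?eqxx ?mul1r.
rewrite big1 ?addr0 // => j /negPf ->; by rewrite mul0r scale0r.
Qed.

Lemma Euler_X N k d v : (0 < k <= N)%N -> U 0 d v ->
  U 1 (d + k) (Euler N (X k v) - (X k (Euler N v) + (2 * k%:R * La4) *: X k v)).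
Proof.
move=> /[dup] kN /andP[k0 _] Uv.
(* The eigenvalue term is spread over the sum as a Kronecker delta, so that the bound can be checked
   summand by summand. *)
rewrite /Euler linear_sum /= -(sum_delta (2 * k%:R * La4) (fun j => X j v) kN).
rewrite -big_split -sumrB /=; apply: wspan_sum_nat => j /andP[j0 _].
have -> : ((j == k)%:R * (2 * k%:R * La4)) *: X j v =
    X j (((j == k)%:R * (2 * k%:R * La4)) *: v) by rewrite linearZ.
have -> : X k (X j (D j v)) = X j (X k (D j v)) -
    (Posz k - Posz j)%:~R *: X (j + k - 2) (D j v).
  by rewrite (XX _ j0 k0) addrK.
rewrite [Z in _ - Z]addrAC opprB addrCA addrC -[X j (X k _) + _]linearD -linearB /=.
apply: wspanD.
  by apply: FilW (X_U j0 (DX_lead j k0 Uv)); lia.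
(* Here [j = k = 1], and the zero coefficient removes [X 0], which is [L 2] and not a letter. *)
have [/eqP jk|jk] := boolP (j + k == 2)%N.
  have -> : j = k by lia.
  by rewrite subrr scale0r; apply: wspan0.
have jk0 : (0 < j + k - 2)%N by lia.
by apply: wspanZ; apply: FilW (X_U jk0 (D_U j Uv)); lia.
Qed.

Lemma Euler_word N s : all (leq 1) s -> (sumn s <= N)%N ->
  U 1 (sumn s) (Euler N (vb s) - (2 * (sumn s)%:R * La4) *: vb s).
Proof.
elim: s => [|k s IH] /=.
  move=> _ _; rewrite mulr0 mul0r scale0r subr0 /Euler big1 => [|j _]; first exact: wspan0.
  by rewrite D_J linear0.
move=> /andP[k0 ps] kN.
have Us : U 0 (sumn s) (vb s) by apply: wspan_mem; rewrite ps gsum_id addn0 /=.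
have kN' : (0 < k <= N)%N by lia.
have sN : (sumn s <= N)%N by lia.
have XE : X k (Euler N (vb s) - (2 * (sumn s)%:R * La4) *: vb s) =
    X k (Euler N (vb s)) - (2 * (sumn s)%:R * La4) *: X k (vb s).
  by rewrite linearB linearZ.
have sub_split (A B p q : V) : A - (p + q) = (A - (B + p)) + (B - q).
  by rewrite [B + p]addrC !opprD !addrA subrK.
rewrite natrD mulrDr mulrDl scalerDl addnC (sub_split _ (X k (Euler N (vb s)))) -XE.
by apply: wspanD; [apply: Euler_X | apply: X_U => //; apply: IH].
Qed.

(** Words of top weight [d - a] have the stated eigenvalue by [Euler_word]. For a lighter word the
    eigenvalue is wrong, but the discrepancy is a multiple of the word, which already lies in the
    lower level. *)
Lemma Euler_lead N a d v : (d <= N)%N -> U a d v ->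
  U a.+1 d (Euler N v - (2 * (d%:R - a%:R) * La4) *: v).
Proof.
move=> dN; set x := 2 * _ * _.
apply: (@wspan_linear _ _ _ (fun u => Euler N u - x *: u)) => [b u w|s /andP[ps]].
  by rewrite linearP scalerDr scalerBr !scalerA [x * b]mulrC opprD addrACA.
rewrite gsum_id => ds; have sN : (sumn s <= N)%N by lia.
rewrite -[Euler N _](subrK ((2 * (sumn s)%:R * La4) *: vb s)) -addrA -scalerBl.
apply: wspanD; first by apply: FilW (Euler_word ps sN); lia.
have [e|ne] := eqVneq (sumn s + a)%N d.
  rewrite /x -e natrD [_ - _](_ : _ = 0) ?scale0r; last by ring.
  exact: wspan0.
by apply: wspanZ; apply: wspan_mem; rewrite ps gsum_id /=; lia.
Qed.

(** * A Poincare lemma for the operators [D j] *)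

Definition approx_primitive (W : nat) (y : nat -> V) : V :=
  (2 * W%:R * La4)^-1 *: \sum_(1 <= j < W.+1) X j (y j).

Lemma approx_primitive_Fil g d W y : (forall j, (0 < j)%N -> Fil g (g j) d (y j)) ->
  Fil g 0 d (approx_primitive W y).
Proof.
move=> Fy; apply: wspanZ; apply: wspan_sum_nat => j /andP[j0 _].
by apply: FilW (X_Fil j0 (Fy j j0)); lia.
Qed.

(** The 1-cocycle condition for the Lie algebra of the [D j] with [j > 0]; by [DD] it holds for
    [y j = D j v]. *)
Definition closed_family (y : nat -> V) : Prop :=
  forall i j, (0 < i)%N -> (0 < j)%N ->
  D i (y j) - D j (y i) = (Posz i - Posz j)%:~R *: y (i + j).+2.

(** Moving [D n] past [X j] yields [2 n La4 y_n] plus the sum of the [X j (D n (y j))]. Closedness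
    turns that sum into [Euler W (y n)] up to lower order, which contributes [2 (W - n) La4 y_n].
    The total [2 W La4 y_n] no longer depends on [n] in its factor, whence the normalization. *)
Lemma approx_primitive_lead W y n : La4 != 0 -> (0 < W)%N ->
  (forall j, (0 < j)%N -> U j W (y j)) ->
  closed_family y -> (0 < n)%N -> U n.+1 W (y n - D n (approx_primitive W y)).
Proof.
move=> La4_neq0 W0 yU yC n0; have [Wn|nW] := ltnP W n.
  rewrite (U_eq0 Wn (yU _ n0)) (U_eq0 Wn (D_U n (approx_primitive_Fil (g := id) W yU))) subr0.
  exact: wspan0.
have lam0 : 2 * W%:R * La4 != 0 by rewrite !mulf_neq0 ?pnatr_eq0 //; lia.
have -> : y n - D n (approx_primitive W y) = - (2 * W%:R * La4)^-1 *:
   (D n (\sum_(1 <= j < W.+1) X j (y j)) - (2 * W%:R * La4) *: y n).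
  rewrite scalerBr scalerA mulNr mulVf // scaleN1r opprK scaleNr addrC.
  by rewrite /approx_primitive linearZ.
apply: wspanZ; rewrite linear_sum /=.
have n0W : (0 < n <= W)%N by lia.
have -> : \sum_(1 <= j < W.+1) D n (X j (y j)) =
    \sum_(1 <= j < W.+1) (D n (X j (y j)) -
      (X j (D j (y n)) + ((j == n)%:R * (2 * n%:R * La4)) *: y j)) +
    (Euler W (y n) + (2 * n%:R * La4) *: y n).
  rewrite -(sum_delta (2 * n%:R * La4) y n0W) /Euler -!big_split /=.
  by apply: eq_bigr => j _; rewrite subrK.
rewrite -addrA; apply: wspanD; last first.
  rewrite -addrA -scalerBl -[_ *: y n]opprK -scaleNr.
  have -> : - (2 * n%:R * La4 - 2 * W%:R * La4) = 2 * (W%:R - n%:R) * La4 by ring.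
  by apply: Euler_lead => //; apply: yU.
apply: wspan_sum_nat => j /andP[j0 _].
have -> : D j (y n) = D n (y j) - (Posz n - Posz j)%:~R *: y (n + j).+2.
  by rewrite -yC // opprB addrC subrK.
rewrite [X j (_ - _)]linearB [X j (_ *: _)]linearZ /=.
rewrite [Z in _ - Z]addrAC opprB addrCA addrC.
have -> : (j == n)%:R * (2 * n%:R * La4) = (n == j)%:R * (2 * j%:R * La4).
  by rewrite eq_sym; case: eqP => [->|_]; rewrite ?mul0r.
apply: wspanD; first by apply: FilW (DX_lead n j0 (yU _ j0)); lia.
have nj0 : (0 < (n + j).+2)%N by [].
by apply: wspanZ; apply: FilW (X_U j0 (yU _ nj0)); lia.
Qed.

Fixpoint primitive (W : nat) (y : nat -> V) : V :=
  if W is W'.+1 then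
    approx_primitive W y + primitive W' (fun j => y j - D j (approx_primitive W y))
  else 0.

(** Each round lowers the weight of the error by one, and the error family is again closed by [DD].
    At [W = 0] nothing is left, because [U j 0] is zero for [j > 0]. *)
Lemma primitive_sol W y : La4 != 0 ->
  (forall j, (0 < j)%N -> U j W (y j)) -> closed_family y ->
  forall j, (0 < j)%N -> D j (primitive W y) = y j.
Proof.
move=> La4_neq0; elim: W y => [|W IH] y yU yC j j0.
  by rewrite linear0 (U_eq0 j0 (yU _ j0)).
rewrite /= linearD /= IH // => [|i i0|i k i0 k0]; first by rewrite addrC subrK.
  by apply: FilW (approx_primitive_lead La4_neq0 _ yU yC i0); lia.
have subACA (p q r t : V) : p - q - (r - t) = p - r - (q - t).
  by rewrite !opprD !opprK addrACA.
by rewrite [D i (_ - _)]linearB [D k (_ - _)]linearB scalerBr -yC // -DD subACA.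
Qed.

(** Here [W] only counts rounds and is unrelated to [g], so one and the same solution obeys the
    bounds of every admissible weight. *)
Lemma primitive_Fil g d W y : filt_weight g ->
  (forall j, (0 < j)%N -> Fil g (g j) d (y j)) -> Fil g 0 d (primitive W y).
Proof.
move=> gw; elim: W y => [|W IH] y Fy /=; first exact: wspan0.
have Fp := approx_primitive_Fil W.+1 Fy.
apply: wspanD => //; apply: IH => j j0; apply: wspanB; first exact: Fy.
by rewrite -[g j]add0n; apply: D_Fil.
Qed.

(** Every summand of a primitive begins with some [X j]; this yields the gauge condition. *)
Lemma primitive_neq_nil W y : (forall v, wspan vb (all (leq 1)) v) ->
  wspan vb (fun s => all (leq 1) s && (s != [::])) (primitive W y).
Proof.
move=> span; elim: W y => [|W IH] y; first exact: wspan0.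
apply: wspanD; last exact: IH.
apply: wspanZ; apply: wspan_sum_nat => j /andP[j0 _].
apply: (wspan_linear (h := X j) _ _ (span (y j))) => [|s ps]; first exact: linearP.
by apply: (@wspan_mem _ _ _ _ (j :: s)); rewrite /= j0 ps.
Qed.

Lemma U_exhaustive v : wspan vb (all (leq 1)) v -> exists W, U 0 W v.
Proof.
move: v; apply: (@wspan_ind _ _ _ _ (fun v => exists W, U 0 W v)) => [|a s v ps [W UW]].
  by exists 0%N; apply: wspan0.
exists (sumn s + W)%N; apply: wspanD; last by apply: FilW UW; lia.
by apply: wspanZ; apply: wspan_mem; rewrite ps gsum_id /=; lia.
Qed.

(** [Euler] kills [u] but acts by a nonzero scalar modulo lower weight, so [u] descends one level at
    a time. *)
Lemma D_kernel W u : La4 != 0 -> U 0 W u -> (forall j, (0 < j)%N -> D j u = 0) -> U 0 0 u.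
Proof.
move=> La4_neq0 + Du; elim: W => [//|W IH] Uu; apply: IH.
have := Euler_lead (leqnn _) Uu.
rewrite /Euler big_nat big1 => [|j /andP[j0 _]]; last by rewrite Du ?linear0.
set x := 2 * _ * _; have x0 : x != 0.
  by rewrite /x subr0 !mulf_neq0 ?pnatr_eq0.
rewrite sub0r -scaleNr => /(wspanZ (- x)^-1).
rewrite scalerA mulVf ?oppr_eq0 // scale1r; apply: FilW; lia.
Qed.

(** * Straightening words into partitions *)

Section Reorder.
Variable g : nat -> nat.
Hypothesis g_sub : forall a b, (2 <= a + b)%N -> (g (a + b - 2) <= g a + g b)%N.

(** The shape of reordering errors: a bracket merges two letters into one, so the length drops yet
    stays positive. *)
Definition shorter (s r : seq nat) : bool :=
  [&& all (leq 1) r, (gsum g r <= gsum g s)%N, (size r < size s)%N & r != [::]].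

Lemma X_shorter x s v : (0 < x)%N ->
  wspan vb (shorter s) v -> wspan vb (shorter (x :: s)) (X x v).
Proof.
move=> x0; apply: wspan_linear => [|r /and4P[pr gr sr _]]; first exact: linearP.
apply: (@wspan_mem _ _ _ _ (x :: r)); rewrite /shorter /= x0 pr /= andbT.
by move: gr; rewrite /gsum /=; lia.
Qed.

Lemma gsum_perm s t : perm_eq s t -> gsum g s = gsum g t.
Proof. by move=> st; rewrite /gsum; apply/perm_sumn/perm_map. Qed.

Lemma shorter_perm s t : perm_eq s t -> shorter s =1 shorter t.
Proof. by move=> st r; rewrite /shorter (gsum_perm st) (perm_size st). Qed.

Lemma word_move x s t : all (leq 1) (x :: s ++ t) ->
  wspan vb (shorter (x :: s ++ t)) (vb (x :: s ++ t) - vb (s ++ x :: t)).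
Proof.
elim: s => [|y s IH] /=; first by rewrite subrr => _; apply: wspan0.
move=> /and3P[x0 y0 pst]; rewrite (XX _ x0 y0) addrAC -linearB /=.
apply: wspanD.
  apply: (@wspanW _ _ _ (shorter (y :: x :: s ++ t))) => [r|].
    by rewrite (@shorter_perm _ [:: x, y & s ++ t]) // -(cat1s y) -(cat1s x) perm_catCA.
  by apply: X_shorter => //; apply: IH; rewrite /= x0.
(* Two positive letters with sum at most 2 are both 1 and commute, so the bracket never produces the
   mode [L 2]. *)
have [xy|xy] := leqP (x + y)%N 2.
  have -> : x = y by lia.
  by rewrite subrr scale0r; apply: wspan0.
apply: wspanZ; apply: (@wspan_mem _ _ _ _ (x + y - 2 :: s ++ t)%N).
rewrite /shorter /= pst ltnSn !andbT /gsum /=.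
have := @g_sub x y; lia.
Qed.

Lemma word_perm s t : all (leq 1) s -> perm_eq s t ->
  wspan vb (shorter s) (vb s - vb t).
Proof.
elim: s t => [|x s IH] t ps.
  by move/perm_size/esym/size0nil => ->; rewrite subrr; apply: wspan0.
move=> st; have xt : x \in t by rewrite -(perm_mem st) inE eqxx.
case/splitPr: xt st => t1 t2 st.
have pt : perm_eq s (t1 ++ t2).
  by rewrite -(perm_cons x) (perm_trans st) // -cat1s perm_catCA.
rewrite -(subrK (vb (x :: t1 ++ t2)) (vb (x :: s))) -addrA; apply: wspanD.
  case/andP: ps => x0 ps.
  by rewrite /= -linearB /=; apply: X_shorter => //; apply: IH.
apply: (@wspanW _ _ _ (shorter (x :: t1 ++ t2))) => [r|].
  by rewrite (@shorter_perm _ (x :: s)) // perm_cons perm_sym.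
apply: word_move; have /perm_all <- // : perm_eq (x :: s) (x :: t1 ++ t2).
by rewrite perm_cons.
Qed.

(** Sorting a word leaves only errors in [shorter], so induction on the length applies. *)
Lemma word_straighten s : all (leq 1) s ->
  wspan vb (fun t => is_part t &&
    ((gsum g t <= gsum g s)%N && ((s != [::]) ==> (t != [::])))) (vb s).
Proof.
have [n] := ubnP (size s); elim: n s => [//|n IH] s sn ps.
have ss : perm_eq s (sort geq s) by rewrite perm_sym perm_sort.
rewrite -(subrK (vb (sort geq s)) (vb s)); apply: wspanD.
  apply: wspan_trans (word_perm ps ss) => r /and4P[pr gr sr r0].
  apply: wspanW (IH r _ pr) => [t /and3P[-> gt /= tr]|]; last by lia.
  rewrite (leq_trans gt gr) /=; apply/implyP => _.
  by rewrite r0 in tr.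
apply: wspan_mem; rewrite /is_part sort_sorted => [|a b]; last exact: leq_total.
rewrite -(perm_all _ ss) ps (gsum_perm ss) leqnn /=.
by rewrite -!size_eq0 (perm_size ss) implybb.
Qed.

End Reorder.

(** * The coefficients of the series *)

Fixpoint psi (k : nat) : V :=
  if k is k'.+1 then primitive (3 * k) (fun j => if j == 3%N then psi k' else 0) else J.

(** The size bound grows by 3 because the source sits at index 3: level [3 k] is [U 3 (3 * k.+1)].
    The source is closed since [i + j + 2] is never 3 for positive [i], [j], and [D n] kills [psi k]
    for positive [n] other than 3. *)
Lemma psi_spec k : La4 != 0 -> U 0 (3 * k) (psi k) /\
  forall j, (0 < j)%N ->
    D j (psi k) = if k is k'.+1 then (if j == 3%N then psi k' else 0) else 0.
Proof.
move=> La4_neq0; elim: k => [|k [IHU IHD]].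
  by split=> [|j _]; [apply: (@wspan_mem _ _ _ _ [::]) | rewrite D_J].
have yU j : (0 < j)%N -> U j (3 * k.+1) (if j == 3%N then psi k else 0).
  by case: eqP => [->|_ _] *; [apply: FilW IHU; lia | apply: wspan0].
split.
  by apply: primitive_Fil yU; split=> [*|*|] /=; [lia | lia | right; lia].
apply: primitive_sol => // i j i0 j0.
have D0 n : (0 < n)%N -> n <> 3%N -> D n (psi k) = 0.
  by move=> n0 /eqP/negPf n3; rewrite IHD // n3; case: (k).
have -> : (i + j).+2 == 3%N = false by lia.
rewrite scaler0; case: eqP => [->|j3]; case: eqP => [->|i3].
- by rewrite subrr.
- by rewrite (D0 i) // linear0 subr0.
- by rewrite (D0 j) // linear0 subr0.
- by rewrite [D i 0]linear0 [D j 0]linear0 subr0.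
Qed.

(** Measured by [g], the source at index 3 costs only one unit per step. *)
Lemma psi_Fil g k : filt_weight g -> g 3 = 1%N -> Fil g 0 k (psi k).
Proof.
move=> gw g3; elim: k => [|k IH].
  by apply: (@wspan_mem _ _ _ _ [::]).
apply: primitive_Fil => // j j0; case: eqP => [->|_]; last exact: wspan0.
by rewrite g3; apply: FilW IH; lia.
Qed.

End Whittaker.

(** * The degree weights, and assembly of the theorem *)

Lemma filt_weight_pdeg (K : numFieldType) (La3 : K) delta :
  (0 < delta <= 2)%N -> delta = 1%N \/ La3 = 0 ->
  filt_weight La3
    (fun i => if i == 1%N then 1%N else if i == 2%N then delta else (i - 2)%N).
Proof.
move=> d12 d1; split=> [a b|a b ab|].
- by do 6?[case: eqP => ?]; lia.
- by do 6?[case: eqP => ?]; lia.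
(* For [delta = 2] monotonicity fails between the letters 2 and 3, of degrees 2 and 1; this is where
   [La3 = 0] enters. *)
- case: d1 => [->|]; [right=> j|by left].
  by do 4?[case: eqP => ?]; lia.
Qed.

Lemma in_spanE (K : fieldType) (V : lmodType K) (L : int -> V -> V) (J : V) P v :
  in_span L J P v = wspan (Defs.vbasis L J) (predI is_part P) v.
Proof. by []. Qed.

Lemma pdeg_mono s : (pdeg 1 s <= pdeg 2 s)%N.
Proof.
rewrite /pdeg; elim: s => [//|i s IH] /=.
by apply: leq_add => //; case: ifP => // _; case: ifP.
Qed.

Theorem theoremA7 (K : numClosedFieldType) (V : lmodType K)
    (c : K) (L : int -> {linear V -> V}) (J : V) (La2 La3 La4 : K) :
  La4 != 0 ->
  virasoro_rep c (fun n => L n) ->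
  L 2%:Z J = La2 *: J -> L 3%:Z J = La3 *: J -> L 4%:Z J = La4 *: J ->
  (forall n : int, 4%:Z < n -> L n J = 0) ->
  is_PBW_basis (fun n => L n) J ->
  let Lf := fun n => (L n : V -> V) in
  let Psi_ok := fun Psi : nat -> V =>
    Psi 0%N = J /\
    (forall k, L 3%:Z (Psi k) = La3 *: Psi k) /\
    (forall k, L 4%:Z (Psi k) = La4 *: Psi k) /\
    (forall k, L 5%:Z (Psi k) = (if k is k'.+1 then Psi k' else 0)) /\
    (forall k (n : int), 5%:Z < n -> L n (Psi k) = 0) /\
    (forall k, xi_is Lf J (Psi k) (k == 0%N)%:R) in
  exists Psi : nat -> V,
    [/\ Psi_ok Psi,
        (forall Psi' : nat -> V, Psi_ok Psi' -> Psi' = Psi),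
        (forall k, Vk Lf J 1 k (Psi k)),
        (forall k v, Vk Lf J 2 k v -> Vk Lf J 1 k v)
      & (La3 = 0 -> forall k, Vk Lf J 2 k (Psi k))].
Proof.
move=> La4n0 virL LJ2 LJ3 LJ4 LJ5 [gen free] Lf Psi_ok.
pose vb := Defs.vbasis Lf J.
have part_pos s : is_part s -> all (leq 1) s by case/andP.
have gen_pos v : wspan vb (all (leq 1)) v.
  by have := gen v; rewrite in_spanE; apply: wspanW => s /andP[/part_pos].
have inI P Q v : in_span Lf J P v -> in_span Lf J Q v -> in_span Lf J (predI P Q) v.
  by rewrite !in_spanE; apply: wspanI.
pose Psi := psi L J La2 La3 La4.
have idw : filt_weight La3 id by split=> [*|*|] /=; [lia | lia | right; lia].
have FilP g v d : filt_weight La3 g -> Fil L J g 0 d v ->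
    in_span Lf J (fun s => gsum g s <= d)%N v.
  move=> [_ gsub _]; rewrite in_spanE; apply: wspan_trans => s /andP[ps]; rewrite addn0 => gs.
  apply: wspanW (word_straighten J virL gsub ps) => t /= /and3P[-> gt _] /=.
  exact: leq_trans gs.
have PsiS k := psi_spec virL LJ2 LJ3 LJ4 LJ5 k La4n0.
have VkPsi delta k : (0 < delta <= 2)%N -> delta = 1%N \/ La3 = 0 ->
    Vk Lf J delta k (Psi k).
  move=> d12 d1; have gw := filt_weight_pdeg d12 d1.
  have sizeP := FilP _ _ _ idw (PsiS k).1.
  have degP := FilP _ _ _ gw (psi_Fil virL LJ2 LJ3 LJ4 LJ5 k gw erefl).
  have := inI _ _ _ sizeP degP; rewrite /Vk !in_spanE; apply: wspanW => s /=.
  by rewrite gsum_id.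
have xi_Psi k : xi_is Lf J (Psi k) (k == 0%N)%:R.
  case: k => [|k]; rewrite /xi_is in_spanE; first by rewrite scale1r subrr; apply: wspan0.
  rewrite scale0r subr0.
  apply: wspan_trans (primitive_neq_nil _ _ _ _ _ gen_pos) => s /andP[ps s0].
  have [_ gsub _] := idw.
  apply: wspanW (word_straighten J virL gsub ps) => t /= /and3P[-> _] /=.
  by rewrite s0.
(* Order by order, the relations for [n = 3], [4], [5] and [n > 5] are the equations for [D j] with
   [j = 1], [2], [3] and [j > 3]. *)
have okD Q : (forall k j, (0 < j)%N -> D L La2 La3 La4 j (Q k) =
      if k is k'.+1 then (if j == 3%N then Q k' else 0) else 0) <->
   [/\ forall k, L 3%:Z (Q k) = La3 *: Q k, forall k, L 4%:Z (Q k) = La4 *: Q k,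
     forall k, L 5%:Z (Q k) = (if k is k'.+1 then Q k' else 0) &
     forall k (n : int), 5%:Z < n -> L n (Q k) = 0].
  split=> [DQ|[Q3 Q4 Q5 Q6] k].
    split=> [k|k|k|k n n5].
    - by apply/eqP; rewrite -subr_eq0; apply/eqP; apply: etrans (DQ k 1%N isT) _; case: (k).
    - by apply/eqP; rewrite -subr_eq0; apply/eqP; apply: etrans (DQ k 2%N isT) _; case: (k).
    - by have := DQ k 3%N isT; rewrite /D La_gt2 // scale0r subr0.
    - have := DQ k `|n - 2|%N; rewrite /D La_gt2; last by lia.
      have -> : 2 + Posz `|n - 2|%N = n by lia.
      rewrite scale0r subr0 => ->; last by lia.
      by case: (k) => // k'; case: eqP => //; lia.
  case=> [|[|[|[|j]]]] // _; rewrite /D.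
  - by rewrite [L _ _]Q3 subrr; case: (k).
  - by rewrite [L _ _]Q4 subrr; case: (k).
  - by rewrite [L _ _]Q5 scale0r subr0; case: (k).
  - by rewrite [L _ _]Q6 ?La_gt2 ?scale0r ?subr0 //; case: (k).
have PsiD k j : (0 < j)%N -> D L La2 La3 La4 j (Psi k) =
    if k is k'.+1 then (if j == 3%N then Psi k' else 0) else 0 := (PsiS k).2 j.
exists Psi; split.
- have [? ? ? ?] := (okD Psi).1 PsiD; by do !split.
- move=> Q [Q0 [Q3 [Q4 [Q5 [Q6 Qxi]]]]]; apply: functional_extensionality.
  have QD := (okD Q).2 (And4 Q3 Q4 Q5 Q6).
  elim=> [//|k IH]; apply/eqP; rewrite -subr_eq0; apply/eqP.
  (* By induction both series have the same source at this order, so all [D j] with [j > 0] kill [u]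
     and it is a multiple of [J]; the gauge puts it in the span of the nonempty partitions, hence it
     is zero. *)
  set u := _ - _.
  have Du j : (0 < j)%N -> D L La2 La3 La4 j u = 0.
    have -> : D L La2 La3 La4 j u = D L La2 La3 La4 j (Q k.+1) -
      D L La2 La3 La4 j (Psi k.+1) by exact: linearB.
    by move=> j0; rewrite QD // PsiD // IH subrr.
  have [W UW] : exists W, Fil L J id 0 W u by apply: U_exhaustive.
  have u0 : in_span Lf J (fun s => s == [::]) u.
    rewrite in_spanE; have := D_kernel virL LJ2 LJ3 LJ4 LJ5 La4n0 UW Du.
    apply: wspanW => s; rewrite gsum_id addn0; case: s => [//|[|i] s] /=; lia.
  have u1 : in_span Lf J (fun s => s != [::]) u.
    have := Qxi k.+1; have := xi_Psi k.+1.
    rewrite /xi_is !in_spanE !scale0r !subr0 => xiP xiQ; exact: wspanB.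
  have := inI _ _ _ u0 u1; rewrite in_spanE; apply: wspan_pred0 => s /=.
  by rewrite andbN andbF.
- by move=> k; apply: VkPsi => //; left.
- move=> k v; rewrite /Vk !in_spanE; apply: wspanW => s /= /and3P[-> -> /=].
  apply: leq_trans.
  exact: pdeg_mono.
- by move=> La30 k; apply: VkPsi => //; right.
Qed.
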